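(* Let $j\ge 2$ be an integer. (1) For any integer $i\ge 2$ and every looped graph $G$ on $n\ge \max(i,j)$ vertices, \[\lambda_i(G)+\lambda_j(\overline{G})\le \frac n2\sqrt{\frac{i+j-2}{(i-1)(j-1)}}.\] Thus $\alpha_{i,j}\le \frac12\sqrt{\frac{i+j-2}{(i-1)(j-1)}}$. (2) For every looped graph $G$ on $n\ge j$ vertices, \[\lambda_1(G)+\lambda_j(\overline{G})\le \frac n2\left(1+\sqrt{\frac{j}{j-1}}\right).\] Thus $\alpha_{1,j}\le \frac12\left(1+\sqrt{\frac{j}{j-1}}\right)$. (3) For every integer $k\ge 1$ and every looped graph $G$ on $n\ge k+1$ vertices, \[\lambda_{k+1}(G)+\lambda_{k+1}(\overline{G})\le \frac{n}{\sqrt{2k}}.\] If there is a symmetric Hadamard matrix of order $2k$, then equality is attained (by some looped graph on some number $n$ of vertices). In particular, if a symmetric Hadamard matrix of order $2k$ exists, then $\alpha_{k+1,k+1}=\frac{1}{\sqrt{2k}}$.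
   Context: A looped graph on $n$ vertices is an undirected graph without multiple edges in which each vertex may carry at most one loop; its adjacency matrix $A(G)$ is the symmetric $n\times n$ $\{0,1\}$-matrix with $(u,v)$ entry $1$ iff $uv$ is an edge (a loop at $v$ gives diagonal entry $1$). The complement $\overline{G}$ of a looped graph is the looped graph with $A(G)+A(\overline{G})=J_n$, the all-ones matrix. Eigenvalues of $A(G)$ are ordered $\lambda_1(G)\ge\cdots\ge\lambda_n(G)$. Let $\mathcal G_n$ be the family of simple (loopless) graphs on $n$ vertices, for which $\overline{G}$ means the usual simple complement. For fixed positive integers $i,j$, \[\alpha_{i,j}=\lim_{n\to\infty}\frac1n\max_{G\in\mathcal G_n}\bigl(\lambda_i(G)+\lambda_j(\overline{G})\bigr),\] a limit which is known to exist (Nikiforov). A Hadamard matrix of order $m$ is an $m\times m$ matrix $H$ with entries $\pm1$ and $HH^T=mI$. *)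

(* Defs.v *)
From HB Require Import structures.
From mathcomp Require Import all_boot all_order all_algebra.
From mathcomp Require Import all_real_closed.
From mathcomp Require Import boolp classical_sets reals topology normedtype.
From mathcomp Require Import sequences.

Set Implicit Arguments.
Unset Strict Implicit.
Unset Printing Implicit Defensive.
Import Order.TTheory GRing.Theory Num.Theory numFieldNormedType.Exports.
Local Open Scope classical_set_scope.
Local Open Scope ring_scope.

Definition symb n (e : {ffun 'I_n * 'I_n -> bool}) : bool :=
  [forall u, forall v, e (u, v) == e (v, u)].

Lemma symbP n (e : {ffun 'I_n * 'I_n -> bool}) :
  reflect (forall u v, e (u, v) = e (v, u)) (symb e).
Proof.
apply: (iffP forallP) => e_sym u.
  by move=> v; have /forallP/(_ v)/eqP := e_sym u.
by apply/forallP => v; apply/eqP.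
Qed.

(* The vertex set is 'I_n; a loop at v is adj G (v, v). *)
Record lgraph (n : nat) := LGraph {
  adj : {ffun 'I_n * 'I_n -> bool};
  adj_symb : symb adj }.

HB.instance Definition _ n := [isSub for @adj n].
HB.instance Definition _ n := [Finite of lgraph n by <:].

Lemma adjC n (G : lgraph n) u v : adj G (u, v) = adj G (v, u).
Proof. exact/symbP/adj_symb. Qed.

Definition loopless n (G : lgraph n) := [forall v, ~~ adj G (v, v)].

Fact lcompl_subproof n (G : lgraph n) :
  symb [ffun p : 'I_n * 'I_n => ~~ adj G p].
Proof. by apply/symbP => u v; rewrite !ffunE adjC. Qed.

(* Loops are complemented too (see adjmx_lcompl). *)
Definition lcompl n (G : lgraph n) := LGraph (lcompl_subproof G).

Fact scompl_subproof n (G : lgraph n) :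
  symb [ffun p : 'I_n * 'I_n => (p.1 != p.2) && ~~ adj G p].
Proof. by apply/symbP => u v; rewrite !ffunE /= adjC eq_sym. Qed.

(* The complement in the sense of simple graphs (see adjmx_scompl). *)
Definition scompl n (G : lgraph n) := LGraph (scompl_subproof G).

Fact edgeless_subproof n : symb [ffun p : 'I_n * 'I_n => false].
Proof. by apply/symbP => u v; rewrite !ffunE. Qed.

Definition edgeless n := LGraph (edgeless_subproof n).

Lemma loopless_edgeless n : loopless (edgeless n).
Proof. by apply/forallP => v; rewrite ffunE. Qed.

Lemma loopless_scompl n (G : lgraph n) : loopless (scompl G).
Proof. by apply/forallP => v; rewrite ffunE /= eqxx. Qed.

Section Spectra.
Variable R : realType.

Definition adjmx n (G : lgraph n) : 'M[R]_n :=
  \matrix_(u, v) (adj G (u, v))%:R.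

Lemma adjmx_sym n (G : lgraph n) : (adjmx G)^T = adjmx G.
Proof. by apply/matrixP => u v; rewrite !mxE adjC. Qed.

Lemma adjmx_lcompl n (G : lgraph n) :
  adjmx G + adjmx (lcompl G) = const_mx 1.
Proof.
apply/matrixP => u v; rewrite !mxE ffunE.
by case: (adj G (u, v)) => /=; rewrite ?addr0 ?add0r.
Qed.

Lemma adjmx_scompl n (G : lgraph n) : loopless G ->
  adjmx G + adjmx (scompl G) = const_mx 1 - 1%:M.
Proof.
move=> /forallP Gl; apply/matrixP => u v; rewrite !mxE ffunE /=.
have [<-|] := eqVneq u v; first by rewrite (negPf (Gl u)) subrr addr0.
by case: (adj G (u, v)) => /=; rewrite ?addr0 ?add0r subr0.
Qed.

(* The real eigenvalues of A, repeated according to their multiplicity as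
   roots of the characteristic polynomial, in nonincreasing order.  If A is
   symmetric there are n of them: see char_poly_eigenvalues. *)
Definition eigenvalues n (A : 'M[R]_n) : seq R :=
  sort >=%R (flatten [seq nseq (mup x (char_poly A)) x
                     | x <- rootsR (char_poly A)]).

(* lambda k G is the k-th largest eigenvalue, counting from k = 1.  It is
   meaningful only for 1 <= k <= n; beyond that range, nth returns 0. *)
Definition lambda (k : nat) n (G : lgraph n) : R :=
  nth 0 (eigenvalues (adjmx G)) k.-1.

Definition lambda_sum (i j n : nat) (G : lgraph n) : R :=
  lambda i G + lambda j (scompl G).

(* The largest value of lambda_sum over the simple graphs on n vertices. *)
Definition max_lambda_sum (i j n : nat) : R :=
  lambda_sum i j
    [arg max_(G > edgeless n | loopless G) lambda_sum i j G]%O.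

(* The sequence converges for all i, j >= 1, by a theorem of Nikiforov.  Its
   terms with n < maxn i j involve eigenvalues out of range, which does not
   affect the limit. *)
Definition alpha (i j : nat) : R :=
  lim ((fun n : nat => max_lambda_sum i j n / n%:R) @ \oo).

Definition hadamard m (H : 'M[R]_m) : Prop :=
  (forall a b, H a b = 1 \/ H a b = -1) /\ H *m H^T = m%:R%:M.

Lemma max_lambda_sumP i j n :
  (exists2 G : lgraph n, loopless G & max_lambda_sum i j n = lambda_sum i j G)
  /\ (forall G : lgraph n, loopless G ->
        lambda_sum i j G <= max_lambda_sum i j n).
Proof.
rewrite /max_lambda_sum; case: arg_maxP; first exact: loopless_edgeless.
by move=> G Gl Gmax; split; [exists G | move=> G' /Gmax].
Qed.

Lemma perm_eigenvalues n (A : 'M[R]_n) (s : seq R) :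
  char_poly A = \prod_(x <- s) ('X - x%:P) -> perm_eq (eigenvalues A) s.
Proof.
move=> pE; have p0 : char_poly A != 0 by rewrite monic_neq0 ?char_poly_monic.
rewrite /eigenvalues perm_sort; apply/allP => y _ /=; apply/eqP.
rewrite count_flatten -!map_comp.
rewrite (eq_map (g := fun x => if x == y then mup y (char_poly A) else 0%N));
  last first.
  by move=> x /=; rewrite count_nseq /=; case: eqP => [->|_]; rewrite ?mul1n.
rewrite sumnE big_map -big_mkcond /=.
have rP := roots_on_rootsR p0.
have rU : uniq (rootsR (char_poly A)) by exact: uniq_roots.
have mE : mup y (char_poly A) = count_mem y s by rewrite pE mu_prod_XsubC.
have [yr|yr] := boolP (y \in rootsR (char_poly A)).
  by rewrite (big_rem y) //= eqxx big1_seq ?addn0 // => x /andP[/eqP-> ];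
     rewrite mem_rem_uniqF.
rewrite big1_seq => [|x /andP[/eqP->]]; last by rewrite (negPf yr).
rewrite -mE mupNroot //; apply: contra yr => yr.
by rewrite -rP !inE yr.
Qed.

Lemma char_poly_eigenvalues n (A : 'M[R]_n) : A^T = A ->
  char_poly A = \prod_(x <- eigenvalues A) ('X - x%:P).
Proof.
move=> Asym.
suff [s sE] : exists s : seq R, char_poly A = \prod_(x <- s) ('X - x%:P).
  by rewrite (perm_big _ (perm_eigenvalues sE)).
pose f := real_complex R; pose B := map_mx f A.
have Bh : B \is hermsymmx.
  apply: realsym_hermsym; first last.
    by apply/mxOverP => a b; rewrite mxE complex_real.
  by apply/is_hermitianmxP; rewrite expr0 scale1r map_mx_id // /B map_trmx Asym.
have dr := hermitian_spectral_diag_real Bh.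
have /orthomx_spectralP BE := hermitian_normalmx Bh.
pose d := spectral_diag B.
exists [seq complex.Re (d 0 k) | k <- enum 'I_n].
apply: (map_poly_inj f); rewrite map_char_poly -/B.
have -> : char_poly B = \prod_(k < n) ('X - (d 0 k)%:P).
  pose P := spectralmx B; pose Pp := map_mx polyC P.
  have PU : P \in unitmx := spectral_unit B.
  have BpE : char_poly_mx B =
      map_mx polyC (invmx P) *m char_poly_mx (diag_mx d) *m Pp.
    rewrite /char_poly_mx mulmxBr mulmxBl [in LHS]BE !map_mxM scalar_mxC.
    by rewrite -[_%:M *m _ *m _]mulmxA -!map_mxM mulVmx //
      map_mx1 mulmx1.
  rewrite /char_poly BpE !det_mulmx mulrAC -det_mulmx -map_mxM mulVmx //.
  rewrite map_mx1 det1 mul1r -/(char_poly _) char_poly_trig.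
    by apply: eq_bigr => k _; rewrite mxE eqxx mulr1n.
  exact: diag_mx_is_trig.
rewrite rmorph_prod /= big_map big_enum /=; apply: eq_bigr => k _.
rewrite rmorphB /= map_polyX map_polyC /=; congr (_ - _%:P).
by rewrite RRe_real //; apply: (mxOverP dr).
Qed.

Lemma size_eigenvalues n (A : 'M[R]_n) : A^T = A -> size (eigenvalues A) = n.
Proof.
move=> /char_poly_eigenvalues /(congr1 (size \o polyseq)) /=.
by rewrite size_char_poly size_prod_XsubC => -[].
Qed.

Lemma sorted_eigenvalues n (A : 'M[R]_n) : sorted >=%R (eigenvalues A).
Proof. by apply: sort_sorted => x y; apply: le_total. Qed.

End Spectra.

(* Main.v *)
Require Import Defs.
From mathcomp Require Import all_boot all_order all_algebra.
From mathcomp Require Import boolp classical_sets topology normedtype sequences.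
From mathcomp Require Import reals.
From mathcomp Require Import ring lra zify.
Import Order.TTheory GRing.Theory Num.Theory numFieldNormedType.Exports.
Local Open Scope classical_set_scope.
Local Open Scope ring_scope.

(* Write the adjacency matrices of a looped graph and of its complement as
   J/2 + E and J/2 - E.  All entries of E are +-1/2, so the squares of its
   eigenvalues add up to n^2/4; as J has rank one and largest eigenvalue n,
   Weyl's inequality turns the sum in question into
   lambda_(i-1)(E) + lambda_(j-1)(-E), which is bounded by Cauchy-Schwarz.

   Equality for i = j = k+1 asks for a symmetric sign matrix C of trace zero
   all of whose nonzero eigenvalues are +-c, where order(C)^2 = 2k c^2.  A
   symmetric Hadamard matrix H of order 2k qualifies when its trace vanishes.
   Otherwise, comparing the integral trace with the eigenvalues +-sqrt(2k)
   shows that 2k = a^2 with a even, and for i, l < a and u, v < 2k the matrix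
   C_((i,u),(l,v)) = (-1)^(i l) H_(l,u) H_(i,v) qualifies.  Blowing C up by
   blocks of alternating sign makes its eigenvectors orthogonal to the all-ones
   vector, so that adding J does not disturb them; deleting the loops moves
   every eigenvalue by at most 1. *)

Set Implicit Arguments.
Unset Strict Implicit.
Unset Printing Implicit Defensive.

(** * Quadratic forms and the eigenvalues of a symmetric matrix *)

Definition qf (R : pzRingType) n (A : 'M[R]_n) (x : 'rV[R]_n) : R :=
  (x *m A *m x^T) 0 0.

Lemma qfD (R : pzRingType) n (A B : 'M[R]_n) x : qf (A + B) x = qf A x + qf B x.
Proof. by rewrite /qf mulmxDr mulmxDl mxE. Qed.

Lemma qfN (R : pzRingType) n (A : 'M[R]_n) x : qf (- A) x = - qf A x.
Proof. by rewrite /qf mulmxN mulNmx mxE. Qed.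

Lemma qfZ (R : comPzRingType) n c (A : 'M[R]_n) x : qf (c *: A) x = c * qf A x.
Proof. by rewrite /qf -scalemxAr -scalemxAl mxE. Qed.

Lemma qf1E (R : comPzRingType) n (x : 'rV[R]_n) : qf 1%:M x = \sum_i x 0 i ^+ 2.
Proof. by rewrite /qf mulmx1 mxE; apply: eq_bigr => i _; rewrite mxE expr2. Qed.

Lemma qf1_gt0 (R : realFieldType) n (x : 'rV[R]_n) : x != 0 -> 0 < qf 1%:M x.
Proof.
move=> x0; rewrite qf1E lt0r sumr_ge0 ?andbT => [|i _]; last exact: sqr_ge0.
apply: contraNneq x0 => /eqP; rewrite psumr_eq0 => [/allP x0|i _];
  last exact: sqr_ge0.
apply/eqP/rowP => k; move: (x0 k); rewrite mem_index_enum mxE => /(_ isT).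
by rewrite sqrf_eq0 => /eqP.
Qed.

(** Completes a unit eigenvector to an orthonormal basis; the reflection needs [v] distinct from the
    first basis vector, hence the case split. *)
Lemma orthogonal_extension (R : realFieldType) n (v : 'rV[R]_(1 + n)) :
  v *m v^T = 1%:M ->
  exists2 Q : 'M[R]_(1 + n), Q *m Q^T = 1%:M & row 0 Q = v.
Proof.
move=> v1; pose e : 'rV[R]_(1 + n) := delta_mx 0 0.
have [<-|ue] := eqVneq e v.
  by exists 1%:M; rewrite ?trmx1 ?mulmx1 // row1.
pose u := v - e; pose c := (u *m u^T) 0 0.
have uuE : u *m u^T = c%:M by rewrite [LHS]mx11_scalar.
have eeE : e *m e^T = 1%:M.
  by rewrite trmx_delta mul_delta_mx; apply/matrixP=> i j; rewrite !mxE !ord1.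
have c0 : c != 0.
  have u0 : u != 0 by rewrite subr_eq0 eq_sym.
  by have := qf1_gt0 u0; rewrite /qf mulmx1 => /lt0r_neq0.
(* For unit vectors the squared length [c] of [v - e] is twice [1 - <e, v>]. *)
have euE : e *m u^T = (- c / 2)%:M.
  rewrite [LHS]mx11_scalar; congr _%:M.
  have veE : (v *m e^T) 0 0 = (e *m v^T) 0 0.
    by rewrite -[in LHS](trmxK v) -trmx_mul mxE.
  have -> : (e *m u^T) 0 0 = (e *m v^T) 0 0 - 1.
    by rewrite /u [(v - e)^T]linearB /= mulmxBr eeE !mxE eqxx.
  have -> : c = 1 - (e *m v^T) 0 0 - ((e *m v^T) 0 0 - 1).
    rewrite /c /u [(v - e)^T]linearB /= mulmxBl !mulmxBr eeE v1 -veE.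
    move: (v *m e^T) (e *m v^T) veE => x y xy; by rewrite !mxE eqxx xy.
  by field.
(* The Householder reflection exchanging e and v. *)
pose Q : 'M_(1 + n) := 1%:M - (2 / c) *: (u^T *m u).
have QT : Q^T = Q by rewrite /Q linearB /= trmx1 linearZ /= trmx_mul trmxK.
exists Q.
  have NN : u^T *m u *m (u^T *m u) = c *: (u^T *m u).
    by rewrite mulmxA -[_ *m u *m u^T]mulmxA uuE mul_mx_scalar -scalemxAl.
  rewrite QT /Q mulmxBr mulmx1 mulmxBl mul1mx -scalemxAr -scalemxAl NN !scalerA.
  by apply/matrixP => i j; rewrite !mxE; field.
rewrite rowE -/e /Q mulmxBr mulmx1 -scalemxAr mulmxA euE mul_scalar_mx scalerA.
have -> : 2 / c * (- c / 2) = -1 by field.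
by rewrite scaleN1r opprK /u addrC subrK.
Qed.

(** Conjugation by an orthogonal matrix whose first row is a unit eigenvector for the largest
    eigenvalue splits that eigenvalue off as a 1 x 1 block. *)
Lemma spectral_deflation (R : realType) n (A : 'M[R]_(1 + n)) : A^T = A ->
  exists (Q : 'M[R]_(1 + n)) (B : 'M[R]_n),
    [/\ Q *m Q^T = 1%:M, B^T = B,
        A = Q^T *m block_mx (nth 0 (eigenvalues A) 0)%:M 0 0 B *m Q
      & eigenvalues A = nth 0 (eigenvalues A) 0 :: eigenvalues B].
Proof.
move=> As; set a := nth 0 _ 0.
have sA : size (eigenvalues A) = n.+1 by rewrite size_eigenvalues.
have : eigenvalue A a.
  rewrite eigenvalue_root_char char_poly_eigenvalues // root_prod_XsubC.
  by rewrite mem_nth // sA.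
move=> /eigenvalueP[w wA w0].
pose s := (w *m w^T) 0 0.
have s0 : 0 < s by have := qf1_gt0 w0; rewrite /qf mulmx1.
pose v := (Num.sqrt s)^-1 *: w.
have v1 : v *m v^T = 1%:M.
  rewrite /v linearZ /= -scalemxAl -scalemxAr scalerA [w *m _]mx11_scalar -/s.
  rewrite scale_scalar_mx -invfM -expr2 sqr_sqrtr ?ltW // mulVf // gt_eqF //.
have vA : v *m A = a *: v by rewrite /v -scalemxAl wA scalerA mulrC -scalerA.
have [Q Q1 Qv] := orthogonal_extension v1.
have Q1' := mulmx1C Q1.
pose M : 'M_(1 + n) := Q *m A *m Q^T.
have MT : M^T = M by rewrite /M !trmx_mul trmxK As mulmxA.
have M0 : row 0 M = a *: delta_mx 0 0.
  rewrite /M !row_mul Qv vA -scalemxAl; congr (_ *: _).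
  by rewrite -Qv -row_mul Q1 row1.
have AE : A = Q^T *m M *m Q by rewrite /M !mulmxA Q1' mul1mx -mulmxA Q1' mulmx1.
have EM : M = Q *m A *m Q^T by [].
clearbody M.
(* The first row of [M] is [a] times the first basis vector; symmetry carries this over to the first
   column. *)
have ME : M = block_mx a%:M 0 0 (drsubmx M).
  have M0j j : M 0 j = a *+ (j == 0).
    by have /rowP/(_ j) := M0; rewrite [LHS]mxE => ->; rewrite !mxE mulr_natr.
  rewrite -[LHS]submxK; congr block_mx.
  - apply/matrixP => i j; rewrite !mxE !ord1 /=.
    by rewrite (_ : lshift n 0 = 0) ?M0j ?eqxx //; apply: val_inj.
  - apply/matrixP => i j; rewrite !mxE !ord1 (_ : lshift n 0 = 0) ?M0j //.
    exact: val_inj.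
  - apply/matrixP => i j; rewrite !mxE !ord1 -MT mxE.
    by rewrite (_ : lshift n 0 = 0) ?M0j //; apply: val_inj.
have BT : (drsubmx M)^T = drsubmx M by rewrite trmx_drsub MT.
exists Q, (drsubmx M); split => //; first by rewrite -ME.
have pA : char_poly A = \prod_(x <- a :: eigenvalues (drsubmx M)) ('X - x%:P).
  rewrite big_cons -char_poly_eigenvalues //.
  have QQ : map_mx polyC Q *m map_mx polyC Q^T = 1%:M.
    by rewrite -map_mxM Q1 map_mx1.
  have -> : char_poly A = char_poly M.
    rewrite /char_poly.
    have -> : char_poly_mx M =
        map_mx polyC Q *m char_poly_mx A *m map_mx polyC Q^T.
      rewrite /char_poly_mx EM mulmxBr mulmxBl !map_mxM scalar_mxC.
      by rewrite -['X%:M *m _ *m _]mulmxA QQ mulmx1.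
    by rewrite !det_mulmx mulrAC -det_mulmx QQ det1 mul1r.
  rewrite [in LHS]ME /char_poly char_block_diag_mx det_ublock; congr (_ * _).
  by rewrite [char_poly_mx a%:M]mx11_scalar det_scalar1 !mxE.
(* By [pA] the two lists are permutations of each other; the right one is sorted because [a] is the
   largest root. *)
apply: (@sorted_eq _ >=%R); first exact: rev_trans le_trans.
- by move=> x y /andP[xy yx]; apply/le_anti/andP.
- exact: sorted_eigenvalues.
- rewrite /= path_sortedE; last exact: rev_trans le_trans.
  rewrite sorted_eigenvalues andbT; apply/allP => x xB.
  have : x \in eigenvalues A.
    by rewrite (perm_mem (perm_eigenvalues pA)) inE xB orbT.
  rewrite /a; have := sorted_eigenvalues A.
  case: (eigenvalues A) => //= y e; rewrite path_sortedE;
    last exact: rev_trans le_trans.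
  by move=> /andP[/allP ye _]; rewrite inE => /predU1P[->//|/ye].
- exact: perm_eigenvalues.
Qed.

(** Repeated deflation produces the diagonal in the order of [eigenvalues], so the rows of [P] are
    eigenvectors indexed like that list. *)
Lemma symmetric_spectral (R : realType) n (A : 'M[R]_n) : A^T = A ->
  exists2 P : 'M[R]_n, P *m P^T = 1%:M &
    A = P^T *m diag_mx (\row_k nth 0 (eigenvalues A) k) *m P.
Proof.
elim: n A => [|n IHn] A As.
  by exists 1%:M; [apply/matrixP => -[] | apply/matrixP => -[]].
rewrite -[n.+1]/(1 + n)%N in A As *.
have [Q [B [Q1 Bs AE eA]]] := spectral_deflation As.
have [P P1 BE] := IHn B Bs.
exists (block_mx 1%:M 0 0 P *m Q).
  rewrite trmx_mul mulmxA -[_ *m Q *m _]mulmxA Q1 mulmx1.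
  rewrite tr_block_mx !trmx0 trmx1.
  by rewrite mulmx_block !mulmx0 !mul0mx P1 mulmx1 !addr0 add0r
    -scalar_mx_block.
rewrite [LHS]AE; set a := nth 0 _ 0.
have -> : (\row_k nth 0 (eigenvalues A) k : 'rV_(1 + n)) =
    row_mx a%:M (\row_k nth 0 (eigenvalues B) k).
  apply/rowP => k; rewrite eA !mxE; case: splitP => j jE; rewrite !mxE jE //.
  by rewrite ord1.
rewrite diag_mx_row trmx_mul tr_block_mx !trmx0 trmx1 [in LHS]BE.
rewrite !mulmxA; congr (_ *m _); rewrite -!mulmxA; congr (_ *m _).
rewrite !mulmx_block !mulmx0 !mul0mx !mul1mx !mulmx1 !addr0 !add0r mulmxA.
rewrite mulmx0 (_ : diag_mx a%:M = a%:M) //.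
by apply/matrixP => i j; rewrite !mxE !ord1.
Qed.

(** * Min-max principle and Weyl's inequality *)

Lemma exists_cap (F : fieldType) m1 m2 n
    (U : 'M[F]_(m1, n)) (V : 'M[F]_(m2, n)) :
  (n < \rank U + \rank V)%N ->
  exists2 x : 'rV[F]_n, x != 0 & (x <= U)%MS /\ (x <= V)%MS.
Proof.
rewrite -mxrank_sum_cap => UV.
have : (U :&: V)%MS != 0.
  rewrite -mxrank_eq0; apply: contraTneq UV => ->.
  by rewrite addn0 -leqNgt rank_leq_col.
by move=> /rowV0Pn[x]; rewrite sub_capmx => /andP[xU xV] x0; exists x.
Qed.

Section CourantFischer.
Variables (R : realType) (n : nat) (A : 'M[R]_n).
Hypothesis As : A^T = A.
Local Notation lam := (nth 0 (eigenvalues A)).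

Lemma eigenvalues_anti k l : (k <= l < n)%N -> lam l <= lam k.
Proof.
move=> /andP[kl ln].
have /(sorted_leq_nth (rev_trans le_trans) (@lexx _ R)) := sorted_eigenvalues A.
by apply; rewrite ?inE ?size_eigenvalues // (leq_ltn_trans kl).
Qed.

Lemma qf_spectral : exists2 P : 'M[R]_n, P *m P^T = 1%:M &
  forall y, qf 1%:M (y *m P) = \sum_(k < n) y 0 k ^+ 2 /\
    qf A (y *m P) = \sum_(k < n) lam k * y 0 k ^+ 2.
Proof.
have [P P1 AE] := symmetric_spectral As; exists P => // y; split.
  by rewrite -qf1E /qf !mulmx1 trmx_mul mulmxA -[y *m P *m _]mulmxA P1 mulmx1.
rewrite /qf [X in y *m P *m X]AE trmx_mul !mulmxA -[y *m P *m _]mulmxA P1.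
rewrite mulmx1 -[_ *m P *m P^T]mulmxA P1 mulmx1 mxE; apply: eq_bigr => k _.
by rewrite mul_mx_diag !mxE; ring.
Qed.

(** [V] is spanned by the eigenvectors of indices 0 to [k]. *)
Lemma exists_qf_ge k : (k < n)%N -> exists2 V : 'M[R]_n, \rank V = k.+1 &
  forall x : 'rV_n, (x <= V)%MS -> lam k * qf 1%:M x <= qf A x.
Proof.
move=> kn; have [P P1 qP] := qf_spectral.
have [PU _] := mulmx1_unit P1.
exists (pid_mx k.+1 *m P) => [|x /submxP[D ->]].
  by rewrite mxrankMfree ?row_free_unit // rank_pid_mx.
rewrite mulmxA; have [-> ->] := qP (D *m pid_mx k.+1).
rewrite mulr_sumr; apply: ler_sum => l _.
have [kl|lk] := leqP k.+1 l.
  have -> : (D *m pid_mx k.+1) 0 l = 0.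
    rewrite mxE big1 // => i _; rewrite mxE; case: eqVneq => [->|_];
      last by rewrite mulr0.
    by rewrite ltnNge kl mulr0.
  by rewrite expr2 !mulr0.
by rewrite ler_wpM2r ?sqr_ge0 // eigenvalues_anti // kn -ltnS lk.
Qed.

(** [V] is spanned by the eigenvectors of index at least [k]; for [k = n] it is zero and the default
    value of [lam n] does no harm. *)
Lemma exists_qf_le k : (k <= n)%N -> exists2 V : 'M[R]_n, \rank V = (n - k)%N &
  forall x : 'rV_n, (x <= V)%MS -> qf A x <= lam k * qf 1%:M x.
Proof.
move=> kn; have [P P1 qP] := qf_spectral.
have [PU _] := mulmx1_unit P1.
exists (copid_mx k *m P) => [|x /submxP[D ->]].
  by rewrite mxrankMfree ?row_free_unit // rank_copid_mx.
rewrite mulmxA; have [-> ->] := qP (D *m copid_mx k).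
rewrite mulr_sumr; apply: ler_sum => l _.
have [lk|kl] := ltnP l k.
  have -> : (D *m copid_mx k) 0 l = 0.
    rewrite mxE big1 // => i _; rewrite !mxE; case: (eqVneq i l) => [->|il].
      by rewrite eqxx lk subrr mulr0.
    by rewrite (negPf (il : i != l :> nat)) subrr mulr0.
  by rewrite expr2 !mulr0.
by rewrite ler_wpM2r ?sqr_ge0 // eigenvalues_anti // kl /=.
Qed.

(** A space of dimension above [k] meets the span of the eigenvectors of index at least [k] in a
    nonzero vector, where both estimates apply. *)
Lemma eigenvalues_lb k m (V : 'M[R]_(m, n)) c : (k < \rank V)%N ->
  (forall x : 'rV_n, (x <= V)%MS -> c * qf 1%:M x <= qf A x) -> c <= lam k.
Proof.
move=> kV cV; have kn : (k < n)%N := leq_trans kV (rank_leq_col V).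
have [W rW lW] := exists_qf_le (ltnW kn).
have [|x x0 [xV xW]] := @exists_cap _ _ _ _ V W; first by rewrite rW; lia.
by rewrite -(ler_pM2r (qf1_gt0 x0)) (le_trans (cV x xV)) ?lW.
Qed.

Lemma eigenvalues_ub k m (V : 'M[R]_(m, n)) c :
  (k < n)%N -> (n - k <= \rank V)%N ->
  (forall x : 'rV_n, (x <= V)%MS -> qf A x <= c * qf 1%:M x) -> lam k <= c.
Proof.
move=> kn kV cV; have [W rW lW] := exists_qf_ge kn.
have [|x x0 [xV xW]] := @exists_cap _ _ _ _ V W; first by rewrite rW; lia.
by rewrite -(ler_pM2r (qf1_gt0 x0)) (le_trans (lW x xW)) ?cV.
Qed.

Lemma sum_eigenvalues : \sum_(k < n) lam k = \tr A.
Proof.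
have [P P1 AE] := symmetric_spectral As.
rewrite [in RHS]AE mxtrace_mulC mulmxA P1 mul1mx mxtrace_diag.
by apply: eq_bigr => k _; rewrite mxE.
Qed.

Lemma sum_sqr_eigenvalues : \sum_(k < n) lam k ^+ 2 = \tr (A *m A).
Proof.
have [P P1 AE] := symmetric_spectral As.
rewrite [in RHS]AE !mulmxA -[_ *m P *m P^T]mulmxA P1 mulmx1.
rewrite mxtrace_mulC !mulmxA P1 mul1mx mulmx_diag mxtrace_diag.
by apply: eq_bigr => k _; rewrite !mxE expr2.
Qed.

Lemma eigenvalues_cube c k : (k < n)%N -> A *m A *m A = c *: A ->
  lam k ^+ 3 = c * lam k.
Proof.
move=> kn; have [P P1 AE] := symmetric_spectral As.
move=> /(congr1 (fun X => P *m X *m P^T)); rewrite -scalemxAr -scalemxAl.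
have PAP : P *m A *m P^T = diag_mx (\row_(k < n) lam k).
  by rewrite [in LHS]AE !mulmxA P1 mul1mx -mulmxA P1 mulmx1.
have -> : P *m (A *m A *m A) *m P^T =
    (P *m A *m P^T) *m (P *m A *m P^T) *m (P *m A *m P^T).
  by rewrite !mulmxA -!(mulmxA _ P^T P) (mulmx1C P1) !mulmx1.
rewrite PAP !mulmx_diag => /matrixP/(_ (Ordinal kn) (Ordinal kn)).
by rewrite !mxE eqxx !mulr1n => <-; rewrite !exprS expr0 mulr1 mulrA.
Qed.

End CourantFischer.

(** Weyl's inequality: the spaces of codimension [k] and [l] on which the two forms are bounded meet
    in codimension at most [k + l]. *)
Lemma eigenvaluesD_le (R : realType) n (A B : 'M[R]_n) k l :
  A^T = A -> B^T = B -> (k + l < n)%N ->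
  nth 0 (eigenvalues (A + B)) (k + l) <=
    nth 0 (eigenvalues A) k + nth 0 (eigenvalues B) l.
Proof.
move=> As Bs kln.
have [|U rU qU] := @exists_qf_le _ _ _ As k; first by lia.
have [|V rV qV] := @exists_qf_le _ _ _ Bs l; first by lia.
apply: (@eigenvalues_ub _ _ _ _ _ _ (U :&: V)%MS) => //.
- by rewrite linearD /= As Bs.
- have := mxrank_sum_cap U V; have := rank_leq_col (U + V)%MS.
  by rewrite rU rV; lia.
move=> x; rewrite sub_capmx => /andP[xU xV].
by rewrite qfD mulrDl lerD ?qU ?qV.
Qed.

Lemma eigenvaluesN_le (R : realType) n (A : 'M[R]_n) k :
  A^T = A -> (k < n)%N ->
  nth 0 (eigenvalues (- A)) k <= - nth 0 (eigenvalues A) (n - k.+1).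
Proof.
move=> As kn.
have [|U rU qU] := @exists_qf_ge _ _ _ As (n - k.+1); first by lia.
apply: (@eigenvalues_ub _ _ _ _ _ _ U) => //.
- by rewrite linearN /= As.
- by rewrite rU; lia.
by move=> x /qU; rewrite qfN mulNr lerN2.
Qed.

(** * Upper bounds *)

(** Weighted Cauchy-Schwarz; the defect is the square of [p * x - q * y] over [p * q]. *)
Lemma add_le_sqrt (R : rcfType) (p q x y s : R) : 0 < p -> 0 < q -> 0 <= s ->
  p * x ^+ 2 + q * y ^+ 2 <= s ^+ 2 -> x + y <= s * Num.sqrt (p^-1 + q^-1).
Proof.
move=> p0 q0 s0 pq; have [|xy] := lerP (x + y) 0.
  by move/le_trans; apply; rewrite mulr_ge0 ?sqrtr_ge0.
have pq0 : 0 <= p^-1 + q^-1 by rewrite addr_ge0 // invr_ge0 ltW.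
rewrite -ler_sqr ?nnegrE ?mulr_ge0 ?sqrtr_ge0 ?(ltW xy) // exprMn sqr_sqrtr //.
apply: le_trans (ler_wpM2r pq0 pq).
have -> : (p * x ^+ 2 + q * y ^+ 2) * (p^-1 + q^-1) =
    (x + y) ^+ 2 + (p * x - q * y) ^+ 2 / (p * q).
  by field; rewrite !gt_eqF.
by rewrite lerDl divr_ge0 ?sqr_ge0 // mulr_ge0 // ltW.
Qed.

(** With [x] and [y] the entries [k] and [n - l.+1] of the spectrum of [E], the sum is at most
    [x - y]; there are [k.+1] eigenvalues at least [x] and [l.+1] at most [y], and the trace bounds
    their squares. *)
Lemma eigenvalues_pair_le (R : realType) n (E : 'M[R]_n) (s : R) k l :
  E^T = E -> 0 <= s -> \tr (E *m E) = s ^+ 2 -> (k < n)%N -> (l < n)%N ->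
  nth 0 (eigenvalues E) k + nth 0 (eigenvalues (- E)) l
    <= s * Num.sqrt (k.+1%:R^-1 + l.+1%:R^-1).
Proof.
move=> Es s0 trE kn ln; have := eigenvaluesN_le Es ln.
set x := nth 0 _ k; set z := nth 0 _ _; set y := nth 0 _ _ => zy.
apply: le_trans (_ : x - y <= _); first by rewrite lerD2l.
(* If the top [k.+1] and the bottom [l.+1] eigenvalues overlap, then [x <= y]. *)
have [lk|kl] := leqP (n - l.+1) k.
  apply: le_trans (_ : 0 <= _); last by rewrite mulr_ge0 ?sqrtr_ge0.
  by rewrite subr_le0 eigenvalues_anti // lk.
(* Truncated at 0, since squares compare only for nonnegative values. *)
pose x' := Num.max x 0; pose y' := Num.max (- y) 0.
apply: le_trans (_ : x' + y' <= _); first by rewrite lerD ?le_max ?lexx.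
apply: add_le_sqrt => //.
have sqr_max (u v : R) : (0 < u -> u <= v) -> Num.max u 0 ^+ 2 <= v ^+ 2.
  move=> uv; case: (lerP u 0) => [_|u0]; first by rewrite expr0n sqr_ge0.
  by rewrite ler_sqr ?nnegrE ?uv // ?(ltW u0) // (le_trans (ltW u0)) ?uv.
rewrite -trE -(sum_sqr_eigenvalues Es) -(big_mkord xpredT (fun a =>
  nth 0 (eigenvalues E) a ^+ 2)).
(* The first [k.+1] squares are at least [x' ^+ 2], the last [l.+1] at least [y' ^+ 2], and those
   between at least 0. *)
rewrite (@big_cat_nat _ _ _ (n - l.+1)) /= ?leq_subr //.
rewrite (@big_cat_nat _ _ _ k.+1 0 (n - l.+1)) //= -addrA.
apply: lerD; last rewrite -[leLHS]add0r; last apply: lerD.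
- rewrite mulr_natl -[X in _ *+ X](subn0 k.+1) -sumr_const_nat.
  apply: ler_sum_nat => a /andP[_ ak]; apply: sqr_max => _.
  by rewrite eigenvalues_anti // -ltnS ak.
- by apply: sumr_ge0 => a _; apply: sqr_ge0.
- have lE : l.+1 = (n - (n - l.+1))%N by lia.
  rewrite [X in X%:R]lE mulr_natl -sumr_const_nat.
  apply: ler_sum_nat => a /andP[la an]; rewrite -[leRHS]sqrrN.
  by apply: sqr_max => _; rewrite lerN2 eigenvalues_anti // la.
Qed.

Lemma sqr_sum_le (R : realFieldType) n (x : 'I_n -> R) :
  (\sum_i x i) ^+ 2 <= n%:R * \sum_i x i ^+ 2.
Proof.
case: n x => [|n] x; first by rewrite !big_ord0 expr0n mulr0.
pose m := (\sum_i x i) / n.+1%:R.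
have : 0 <= \sum_i (x i - m) ^+ 2 by apply: sumr_ge0 => i _; apply: sqr_ge0.
have -> : \sum_i (x i - m) ^+ 2 =
    \sum_i x i ^+ 2 + (\sum_i x i) * (- 2 * m) + m ^+ 2 * n.+1%:R.
  rewrite -[X in _ + _ + _ * X%:R](card_ord n.+1) mulr_natr -sumr_const.
  rewrite mulr_suml -!big_split /=.
  by apply: eq_bigr => i _; ring.
have n0 : 0 < n.+1%:R :> R by [].
have -> : \sum_i x i = m * n.+1%:R by rewrite /m divfK ?gt_eqF.
move: (\sum_i _) => Q h.
have : 0 <= n.+1%:R * (Q + m * n.+1%:R * (-2 * m) + m ^+ 2 * n.+1%:R).
  by rewrite mulr_ge0 // ltW.
lra.
Qed.

Lemma qf_const_mx (R : comPzRingType) n (a : R) (x : 'rV[R]_n) :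
  qf (const_mx a) x = a * (\sum_i x 0 i) ^+ 2.
Proof.
rewrite /qf mxE expr2 mulr_sumr mulr_sumr; apply: eq_bigr => j _.
rewrite mxE [x^T j 0]mxE mulrA; congr (_ * _); rewrite mulr_sumr.
by apply: eq_bigr => i _; rewrite mxE mulrC.
Qed.

Lemma eigenvalues0_const_mx (R : realType) n (a : R) : 0 <= a -> (0 < n)%N ->
  nth 0 (eigenvalues (const_mx a : 'M[R]_n)) 0 <= a * n%:R.
Proof.
move=> a0 n0; apply: (@eigenvalues_ub _ _ _ _ _ _ 1%:M) => //.
- by rewrite trmx_const.
- by rewrite mxrank1 subn0.
move=> x _; rewrite qf_const_mx qf1E -mulrA ler_wpM2l //; exact: sqr_sum_le.
Qed.

(** The form vanishes on the hyperplane of vectors with coordinate sum 0. *)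
Lemma eigenvalues1_const_mx (R : realType) n (a : R) : (1 < n)%N ->
  nth 0 (eigenvalues (const_mx a : 'M[R]_n)) 1 <= 0.
Proof.
move=> n1; pose V := kermx (const_mx 1 : 'cV[R]_n).
apply: (@eigenvalues_ub _ _ _ _ _ _ V) => //.
- by rewrite trmx_const.
- by rewrite mxrank_ker leq_sub2l // rank_leq_col.
move=> x /sub_kermxP /matrixP/(_ 0 0); rewrite !mxE qf_const_mx mul0r.
under eq_bigr do rewrite mxE mulr1.
by move=> ->; rewrite expr0n mulr0.
Qed.

(** A rank-one summand costs one index and nothing in size. *)
Lemma eigenvaluesS_const_mxD (R : realType) n (a : R) (E : 'M[R]_n) k :
  E^T = E -> (k.+1 < n)%N ->
  nth 0 (eigenvalues (const_mx a + E)) k.+1 <= nth 0 (eigenvalues E) k.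
Proof.
move=> Es kn; have n1 : (1 < n)%N by exact: leq_trans kn.
have := @eigenvaluesD_le _ _ (const_mx a) E 1 k (trmx_const _ _ _) Es kn.
by rewrite add1n => /le_trans; apply; rewrite gerDr eigenvalues1_const_mx.
Qed.

Section UpperBounds.
Variables (R : realType) (n : nat) (G : lgraph n).

Let E : 'M[R]_n := adjmx R G - const_mx 2^-1.

Let Es : E^T = E.
Proof. by rewrite /E linearB /= adjmx_sym trmx_const. Qed.

Let trE : \tr (E *m E) = (n%:R / 2) ^+ 2.
Proof.
rewrite /mxtrace.
have -> : \sum_i (E *m E) i i = \sum_(i < n) n%:R / 4.
  apply: eq_bigr => i _; rewrite mxE.
  rewrite mulr_natl -[in RHS](card_ord n) -sumr_const; apply: eq_bigr => j _.
  have -> : E j i = E i j by rewrite -[in LHS]Es mxE.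
  by rewrite !mxE; case: (adj G (i, j)) => /=; field.
by rewrite sumr_const card_ord -mulr_natl; field.
Qed.

Let AE : adjmx R G = const_mx 2^-1 + E.
Proof. by rewrite /E addrC subrK. Qed.

Let BE : adjmx R (lcompl G) = const_mx 2^-1 - E.
Proof.
apply/matrixP => u v; rewrite /E !mxE ffunE.
by case: (adj G (u, v)) => /=; field.
Qed.

(** [lambda] counts from 1, lists from 0: [lambda R k.+2] is entry [k.+1], which removal of the
    rank-one part bounds by entry [k] of [E]. *)
Lemma lambda_pair_le k l : (maxn k.+2 l.+2 <= n)%N ->
  lambda R k.+2 G + lambda R l.+2 (lcompl G)
    <= n%:R / 2 * Num.sqrt (k.+1%:R^-1 + l.+1%:R^-1).
Proof.
rewrite geq_max => /andP[kn ln]; rewrite /lambda /= AE BE.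
apply: le_trans (@eigenvalues_pair_le _ _ E _ k l _ _ _ _ _) => //; try lia;
  last first.
  by rewrite divr_ge0.
by apply: lerD; apply: eigenvaluesS_const_mxD => //; rewrite linearN /= Es.
Qed.

(** Index 1 cannot absorb the rank-one part, which contributes its whole eigenvalue [n / 2]; the
    eigenvalues of [E] and [- E] then have weights 1 and [l.+1]. *)
Lemma lambda1_pair_le l : (l.+2 <= n)%N ->
  lambda R 1 G + lambda R l.+2 (lcompl G)
    <= n%:R / 2 * (1 + Num.sqrt (1 + l.+1%:R^-1)).
Proof.
move=> ln; rewrite /lambda /= AE BE mulrDr mulr1.
have [n0 n1] : (0 < n)%N /\ (1 < n)%N by lia.
have J0 : nth 0 (eigenvalues (const_mx 2^-1 : 'M[R]_n)) 0 <= n%:R / 2.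
  by rewrite [leRHS]mulrC eigenvalues0_const_mx ?invr_ge0.
apply: le_trans (_ : n%:R / 2 + nth 0 (eigenvalues E) 0 +
  nth 0 (eigenvalues (- E)) l <= _).
  apply: lerD.
    by apply: le_trans (@eigenvaluesD_le _ _ _ _ 0 0 _ _ _) _;
      rewrite ?trmx_const ?lerD.
  by apply: eigenvaluesS_const_mxD => //; rewrite linearN /= Es.
rewrite -addrA lerD2l -[X in X + _^-1]invr1.
by apply: (@eigenvalues_pair_le _ _ E _ 0 l) => //; [rewrite divr_ge0|lia].
Qed.

End UpperBounds.

(** * From looped to simple complements, and to the limit *)

Lemma eigenvaluesD_le0 (R : realType) n (A D : 'M[R]_n) c k :
  A^T = A -> D^T = D -> (k < n)%N -> (forall x, qf D x <= c * qf 1%:M x) ->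
  nth 0 (eigenvalues (A + D)) k <= nth 0 (eigenvalues A) k + c.
Proof.
move=> As Ds kn Dc; have kn0 : (k + 0 < n)%N by rewrite addn0.
rewrite -[X in nth _ _ X]addn0; apply: le_trans (eigenvaluesD_le As Ds kn0) _.
rewrite lerD2l; apply: (@eigenvalues_ub _ _ _ _ _ _ 1%:M) => //.
- exact: leq_ltn_trans kn.
- by rewrite mxrank1 subn0.
Qed.

(** For loopless [G] the looped complement has every loop; dropping them subtracts the identity,
    whose form is nonnegative. *)
Lemma lambda_scompl_le (R : realType) n (G : lgraph n) k : loopless G ->
  (0 < k <= n)%N -> lambda R k (scompl G) <= lambda R k (lcompl G).
Proof.
move=> Gl /andP[k0 kn]; rewrite /lambda.
have -> : adjmx R (scompl G) = adjmx R (lcompl G) + (- 1%:M).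
  apply: (addrI (adjmx R G)); rewrite adjmx_scompl //.
  by rewrite -(adjmx_lcompl R G) addrA.
rewrite -[leRHS]addr0; apply: eigenvaluesD_le0; rewrite ?adjmx_sym //.
- by rewrite linearN /= trmx1.
- by case: k k0 kn.
by move=> x; rewrite qfN mul0r oppr_le0 qf1E sumr_ge0 // => i _; apply: sqr_ge0.
Qed.

Lemma max_lambda_sum_le (R : realType) i j n (b : R) : (0 < i)%N -> (0 < j)%N ->
  (maxn i j <= n)%N ->
  (forall G : lgraph n, lambda R i G + lambda R j (lcompl G) <= b) ->
  max_lambda_sum R i j n <= b.
Proof.
move=> i0 j0 ijn Gb; have [[G Gl ->] _] := max_lambda_sumP R i j n.
apply: le_trans (Gb G); rewrite lerD2l lambda_scompl_le //.
by rewrite j0 (leq_trans (leq_maxr i j)).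
Qed.

Lemma alpha_le (R : realType) i j (b : R) : (0 < i)%N -> (0 < j)%N -> 0 <= b ->
  (forall n (G : lgraph n), (maxn i j <= n)%N ->
     lambda R i G + lambda R j (lcompl G) <= n%:R * b) ->
  alpha R i j <= b.
Proof.
move=> i0 j0 b0 Gb; rewrite /alpha.
(* The limit of a divergent sequence is 0 by convention. *)
have [cv|/dvgP->//] := pselect (cvg ((fun n =>
  max_lambda_sum R i j n / n%:R) @ \oo)).
apply: limr_le => //; near=> n.
have n0 : (maxn i j <= n)%N by near: n; exact: nbhs_infty_ge.
have n1 : (0 < n)%N by rewrite (leq_trans _ n0) // leq_max i0.
rewrite ler_pdivrMr ?ltr0n // mulrC; apply: max_lambda_sum_le => // G.
exact: Gb.
Unshelve. all: by end_near. Qed.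

(** * Blow-ups of flat sign matrices *)

Lemma cube_eqP (R : idomainType) (x c : R) : x ^+ 3 = c ^+ 2 * x ->
  [\/ x = 0, x = c | x = - c].
Proof.
move=> /eqP; rewrite -subr_eq0.
have -> : x ^+ 3 - c ^+ 2 * x = x * ((x - c) * (x + c)) by ring.
rewrite !mulf_eq0 subr_eq0 addr_eq0 => /or3P[] /eqP ->.
- by constructor 1.
- by constructor 2.
- by constructor 3.
Qed.

(** All eigenvalues are 0 or plus or minus [c]. Trace zero makes both signs equally frequent, and
    the trace of the square counts [2 * k.+1] nonzero ones, so [c] occurs [k.+1] times. *)
Lemma eigenvalue_ge_flat (R : realType) n (C : 'M[R]_n) c k :
  C^T = C -> 0 < c -> C *m C *m C = c ^+ 2 *: C -> \tr C = 0 ->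
  \tr (C *m C) = (2 * k.+1)%:R * c ^+ 2 ->
  c <= nth 0 (eigenvalues C) k.
Proof.
move=> Cs c0 C3 trC trCC; set lam := nth 0 (eigenvalues C).
have lamE l : (l < n)%N -> [\/ lam l = 0, lam l = c | lam l = - c].
  by move=> ln; apply/cube_eqP/(eigenvalues_cube Cs).
rewrite leNgt; apply/negP => lam_k.
(* [c x + x^2] is [2 c^2] at [x = c] and vanishes at [0] and [- c]. *)
have sumE : \sum_(0 <= l < n) (c * lam l + lam l ^+ 2) = (2 * k.+1)%:R * c ^+ 2.
  rewrite big_mkord big_split /= -mulr_sumr sum_eigenvalues // trC mulr0 add0r.
  by rewrite sum_sqr_eigenvalues.
have c20 : 0 < c ^+ 2 by rewrite exprn_gt0.
have small l : (l < n)%N -> c * lam l + lam l ^+ 2 <= 2 * c ^+ 2.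
  by move=> /lamE[] ->; rewrite ?mulr0 ?expr0n ?addr0 ?sqrrN; nra.
have neg l : (k <= l < n)%N -> c * lam l + lam l ^+ 2 <= 0.
  move=> kln; have := le_lt_trans (eigenvalues_anti Cs kln) lam_k.
  by case/andP: kln => _ /lamE; rewrite -/lam => -[] ->;
    rewrite ?ltxx // => _; nra.
suff : (2 * k.+1)%:R * c ^+ 2 <= (2 * k)%:R * c ^+ 2.
  by rewrite ler_pM2r // ler_nat; lia.
(* [k < n] is not yet known, so the split point is capped at [n]. *)
rewrite -sumE (@big_cat_nat _ _ _ (minn k n)) ?geq_minr //= -[leRHS]addr0.
apply: lerD; last first.
  rewrite big_nat; apply: sumr_le0 => l.
  rewrite geq_min => /andP[/orP[kl|nl] ln].
    by rewrite neg ?kl.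
  by rewrite leqNgt ln in nl.
apply: le_trans (_ : \sum_(0 <= l < minn k n) 2 * c ^+ 2 <= _).
  by apply: ler_sum_nat => l /andP[_]; rewrite leq_min => /andP[_ /small].
rewrite sumr_const_nat subn0 -[leLHS]mulr_natr [leLHS]mulrAC ler_pM2r // -natrM
  ler_nat.
by rewrite leq_mul2l geq_minl orbT.
Qed.

Lemma sum_modn_divn (V : nmodType) p m (f : nat -> nat -> V) : (0 < p)%N ->
  \sum_(0 <= v < m * p) f (v %% p)%N (v %/ p)%N =
    \sum_(0 <= q < m) \sum_(0 <= i < p) f i q.
Proof.
move=> p0; elim: m => [|m IHm]; first by rewrite mul0n !big_geq.
rewrite big_nat_recr //= -IHm (@big_cat_nat _ _ _ (m * p)) ?leq_mul //=.
congr (_ + _); rewrite -{1}[(m * p)%N]add0n big_addn mulSn addnK.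
rewrite big_nat [RHS]big_nat; apply: eq_bigr => i /andP[_ ip].
by rewrite addnC modnMDl divnMDl // modn_small // divn_small // addn0.
Qed.

Section BlowUp.
Variables (R : realType) (p n : nat) (C : 'M[R]_p).
Hypothesis p0 : (0 < p)%N.
Hypothesis Cs : C^T = C.
Hypothesis C1 : forall i j, C i j = 1 \/ C i j = -1.

(** Vertex [v] lies in block [v %/ p] at position [v %% p]; the last block may be incomplete, so [n]
    is arbitrary. *)
Definition residue (v : 'I_n) : 'I_p := Ordinal (ltn_pmod v p0).

Definition block_sign (v : 'I_n) : R := (-1) ^+ (v %/ p).

Definition blowup_entry (u v : 'I_n) : R :=
  block_sign u * C (residue u) (residue v) * block_sign v.

Lemma blowup_entryC u v : blowup_entry u v = blowup_entry v u.
Proof.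
rewrite /blowup_entry (_ : C (residue u) _ = C (residue v) (residue u)).
  by ring.
by rewrite -[in LHS]Cs mxE.
Qed.

Lemma blowup_entry_sign u v : blowup_entry u v = 1 \/ blowup_entry u v = -1.
Proof.
rewrite /blowup_entry /block_sign -signr_odd -[(-1) ^+ (v %/ p)]signr_odd.
by case: (C1 (residue u) (residue v)) => ->; case: (odd _); case: (odd _);
  rewrite !(mulr1, mul1r, mulrN1, opprK) /=; auto.
Qed.

Fact blowup_subproof :
  symb [ffun e : 'I_n * 'I_n => blowup_entry e.1 e.2 == 1].
Proof. by apply/symbP => u v; rewrite !ffunE /= blowup_entryC. Qed.

Definition blowup : lgraph n := LGraph blowup_subproof.

(** Signed incidence matrix of positions and vertices: the sign matrix of the blow-up factors as
    [S^T *m C *m S]. *)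
Let S : 'M[R]_(p, n) := \matrix_(i, v) (block_sign v *+ (i == residue v)).

Lemma adjmx_blowup : adjmx R blowup = const_mx 2^-1 + 2^-1 *: (S^T *m C *m S).
Proof.
apply/matrixP => u v.
have : (S^T *m C *m S) u v = blowup_entry u v.
  rewrite mxE (bigD1 (residue v)) //= big1 => [|j jv]; last first.
    by rewrite [S _ _]mxE (negPf jv) mulr0.
  rewrite addr0 [S _ _]mxE eqxx mulr1n mxE (bigD1 (residue u)) //= big1 =>
    [|j ju].
    by rewrite addr0 !mxE eqxx mulr1n.
  by rewrite !mxE (negPf ju) mul0r.
move: (S^T *m C *m S) => X XE; rewrite !mxE XE ffunE /=.
case: (blowup_entry_sign u v) => ->.
  by rewrite eqxx /=; field.
by rewrite lt_eqF ?(lt_trans (ltrN10 _)) ?ltr01 //=; field.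
Qed.

(* The test vectors live on the first [2 t] blocks of length [p], where the
   signs cancel; the remaining vertices may be joined in any way. *)
Variable t : nat.
Hypothesis tpn : (t.*2 * p <= n)%N.
Let m := t.*2.

Let o : 'rV[R]_n := \row_v (v < m * p)%N%:R.

Let sum_o (f : nat -> nat -> R) :
  \sum_(v < n) (v < m * p)%N%:R * f (v %% p)%N (v %/ p)%N =
    \sum_(0 <= q < m) \sum_(0 <= i < p) f i q.
Proof.
rewrite -sum_modn_divn // -(big_mkord xpredT (fun v =>
  (v < m * p)%N%:R * f (v %% p)%N (v %/ p)%N)).
rewrite (@big_cat_nat _ _ _ (m * p)) //= [X in _ + X]big_nat [X in _ + X]big1
  ?addr0 => [|v].
  by rewrite big_nat [RHS]big_nat; apply: eq_bigr => v /andP[_ ->];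
    rewrite mul1r.
by move=> /andP[mv _]; rewrite ltnNge mv mul0r.
Qed.

(** Each position occurs once in each of the [m] blocks, and block signs square to 1. *)
Let S1 : S *m diag_mx o *m S^T = m%:R%:M.
Proof.
apply/matrixP => i j; rewrite mxE [RHS]mxE.
under eq_bigr => v _.
  rewrite mul_mx_diag !mxE.
  rewrite (_ : _ * _ = (v < m * p)%N%:R *
    ((i == v %% p :> nat) && (j == v %% p :> nat))%N%:R); last first.
    rewrite /block_sign -!val_eqE /=; case: eqP; case: eqP => _ _;
      rewrite /= ?mulr0n ?mul0r ?mulr0 // !mulr1n.
    by rewrite mulrAC -expr2 sqrr_sign mulrC.
  over.
rewrite (sum_o (fun r q => ((i == r :> nat) && (j == r :> nat))%:R)).
have -> : \sum_(0 <= r < p) ((i == r :> nat) && (j == r :> nat))%:R =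
    (i == j)%:R :> R.
  rewrite big_mkord (bigD1 i) //= eqxx /= big1 ?addr0 1?eq_sym // => l li.
  by rewrite [(i == l :> nat)](_ : _ = false) // eq_sym; apply: negPf.
by rewrite sumr_const_nat subn0 mulrnAC.
Qed.

(** Along a fixed position the block signs alternate, and [m] is even. *)
Let So : S *m o^T = 0.
Proof.
apply/matrixP => i j; rewrite mxE [RHS]mxE.
under eq_bigr => v _.
  rewrite !mxE /block_sign -val_eqE /= mulrC.
  over.
rewrite (sum_o (fun r q => (-1) ^+ q *+ (i == r :> nat))) exchange_big /=
  big1_seq // => r _.
rewrite big_mkord sumrMnl.
suff -> : \sum_(q < m) (-1) ^+ q = 0 :> R by rewrite mul0rn.
by rewrite /m; elim: t => [|s IHs];
  rewrite ?big_ord0 // doubleS !big_ord_recr /= IHs exprS; ring.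
Qed.

Let oTo : o *m o^T = (m * p)%:R%:M.
Proof.
apply/matrixP => i j; rewrite mxE !ord1 [RHS]mxE eqxx mulr1n.
under eq_bigr => v _.
  rewrite !mxE; rewrite (_ : _ * _ = (v < m * p)%N%:R * 1); last first.
    by case: ltnP; rewrite ?mulr1 ?mulr0.
  over.
rewrite (sum_o (fun _ _ => 1)) natrM mulr_natl -[in RHS](subn0 m)
  -sumr_const_nat.
by apply: eq_bigr => q _; rewrite sumr_const_nat subn0.
Qed.

Let o1 : \sum_v o 0 v = (m * p)%:R.
Proof.
have /matrixP/(_ 0 0) := oTo; rewrite [RHS]mxE eqxx mulr1n => <-; rewrite mxE.
by apply: eq_bigr => v _; rewrite !mxE; case: ltnP; rewrite ?mulr1 ?mulr0.
Qed.

Let So_sum (z : 'rV[R]_p) : \sum_v (z *m S *m diag_mx o) 0 v = 0.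
Proof.
transitivity ((z *m (S *m o^T)) 0 0); last by rewrite So mulmx0 mxE.
rewrite mulmxA mxE; apply: eq_bigr => v _.
by rewrite mul_mx_diag [LHS]mxE [o^T _ _]mxE.
Qed.

(** Test vectors: a multiple of [o] plus the signed copy of [z] on the test blocks, orthogonal to
    each other by [So]. *)
Let vec a (z : 'rV[R]_p) := a *: o + z *m S *m diag_mx o.

Let oDE : o *m diag_mx o = o.
Proof.
by apply/rowP => v; rewrite mul_mx_diag !mxE; case: ltnP; rewrite ?mulr1 ?mulr0.
Qed.

Let DD : diag_mx o *m diag_mx o = diag_mx o.
Proof.
rewrite mulmx_diag; congr diag_mx; apply/rowP => v.
by rewrite !mxE; case: ltnP; rewrite ?mulr1 ?mulr0.
Qed.

Let vecS a z : vec a z *m S^T = m%:R *: z.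
Proof.
have oS : o *m S^T = 0 by rewrite -[o]trmxK -trmx_mul So trmx0.
rewrite mulmxDl -scalemxAl oS scaler0 add0r -!mulmxA [S *m _]mulmxA S1.
by rewrite mul_mx_scalar.
Qed.

Let qf1_vec a z : qf 1%:M (vec a z) = a ^+ 2 * (m * p)%:R + m%:R * qf 1%:M z.
Proof.
rewrite /qf !mulmx1.
have -> : vec a z *m (vec a z)^T =
    a ^+ 2 *: (o *m o^T) + z *m (S *m diag_mx o *m S^T) *m z^T.
  rewrite {2}/vec linearD /= linearZ /= !trmx_mul tr_diag_mx mulmxDr.
  congr (_ + _).
    rewrite -scalemxAr mulmxDl -scalemxAl scalerDr scalerA -expr2.
    rewrite -[z *m S *m _ *m _]mulmxA (_ : diag_mx o *m o^T = o^T).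
      by rewrite -mulmxA So mulmx0 scaler0 addr0.
    by rewrite -[in RHS]oDE trmx_mul tr_diag_mx.
  have oS : o *m S^T = 0 by rewrite -[o]trmxK -trmx_mul So trmx0.
  rewrite mulmxDl -scalemxAl !mulmxA oDE oS mul0mx scaler0 add0r.
  by rewrite -[z *m S *m _ *m _]mulmxA DD.
by rewrite oTo S1 mul_mx_scalar -scalemxAl !mxE eqxx mulr1n.
Qed.

(** The all-ones part sees only [a], since signed copies sum to 0; the sign part sees only [z],
    since [S] kills [o]. *)
Let qf_vec a z : qf (adjmx R blowup) (vec a z) =
  2^-1 * (a * (m * p)%:R) ^+ 2 + 2^-1 * m%:R ^+ 2 * qf C z.
Proof.
rewrite adjmx_blowup qfD qf_const_mx qfZ -mulrA; congr (_ * _ ^+ 2 + _ * _).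
  under eq_bigr do rewrite mxE [(a *: o) 0 _]mxE.
  by rewrite big_split /= -mulr_sumr o1 So_sum addr0.
rewrite /qf !mulmxA vecS -mulmxA -[S *m _]trmxK trmx_mul trmxK vecS.
by rewrite linearZ /= -!scalemxAl -scalemxAr !mxE expr2 mulrA.
Qed.

(** The test space joins [o] to the copies of the [k.+1] top eigenvectors of [C], hence the index
    [k.+1]. The Rayleigh quotient is [t * p] on [o] and at least [t * c] on the copies. *)
Lemma blowup_eigenvalue_ge c k : (0 < t)%N -> 0 <= c <= p%:R -> (k < p)%N ->
  c <= nth 0 (eigenvalues C) k ->
  t%:R * c <= nth 0 (eigenvalues (adjmx R blowup)) k.+1.
Proof.
move=> t0 /andP[c0 cp] kp cC.
have m0 : 0 < m%:R :> R by rewrite ltr0n /m double_gt0.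
have p0' : 0 < p%:R :> R by rewrite ltr0n.
have mt : m%:R = 2 * t%:R :> R by rewrite /m -muln2 natrM mulrC.
have [V rV qV] := exists_qf_ge Cs kp.
pose W := row_base V.
have WV (y : 'rV_(\rank V)) : (y *m W <= V)%MS.
  by rewrite (submx_trans (submxMl _ _)) // eq_row_base.
have cW y : c * qf 1%:M (y *m W) <= qf C (y *m W).
  apply: le_trans (qV _ (WV y)); rewrite ler_wpM2r //.
  by rewrite qf1E sumr_ge0 // => i _; apply: sqr_ge0.
pose X : 'M_(1 + \rank V, n) := col_mx o (W *m S *m diag_mx o).
have XE y : y *m X = vec (lsubmx y 0 0) (rsubmx y *m W).
  rewrite -[y in LHS]hsubmxK mul_row_col !mulmxA; congr (_ + _).
  by rewrite [lsubmx y in LHS]mx11_scalar mul_scalar_mx.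
have Xfree : row_free X.
  apply: inj_row_free => y yX.
  have := qf1_vec (lsubmx y 0 0) (rsubmx y *m W); rewrite -XE yX.
  rewrite {1}/qf !mul0mx mxE => /esym/eqP.
  have q0 : 0 <= qf 1%:M (rsubmx y *m W).
    by rewrite qf1E sumr_ge0 // => i _; apply: sqr_ge0.
  rewrite paddr_eq0 ?(mulr_ge0 (sqr_ge0 _)) ?(mulr_ge0 (ler0n _ _)) ?ler0n //.
  rewrite natrM !mulf_eq0 orbb (gt_eqF m0) (gt_eqF p0') !orbF /=.
  move=> /andP[/eqP y0 yW]; rewrite -[y]hsubmxK [lsubmx y]mx11_scalar y0.
  have [yW0|/qf1_gt0] := eqVneq (rsubmx y *m W) 0; last by rewrite lt0r yW.
  have -> : rsubmx y = 0.
    by apply: (row_free_inj (row_base_free V)); rewrite mul0mx.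
  by rewrite raddf0 row_mx0.
apply: (@eigenvalues_lb _ _ _ (adjmx_sym _ _) _ _ X).
  by rewrite (eqP Xfree) rV add1n.
move=> x /submxP[y ->]; rewrite XE qf1_vec qf_vec mt natrM mt.
move: (lsubmx y 0 0) (cW (rsubmx y)) => a cWy.
have tt0 : 0 < t%:R :> R by rewrite ltr0n.
(* The right-hand sides of [h1] and [h2] add up to the difference to be shown nonnegative. *)
have h1 : 0 <= 2 * t%:R ^+ 2 *
    (qf C (rsubmx y *m W) - c * qf 1%:M (rsubmx y *m W)).
  by rewrite mulr_ge0 ?subr_ge0 // mulr_ge0 // sqr_ge0.
have h2 : 0 <= 2 * p%:R * (p%:R - c) * (t%:R * a) ^+ 2.
  by rewrite mulr_ge0 ?sqr_ge0 // mulr_ge0 ?subr_ge0 ?mulr_ge0.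
move: h1 h2; nra.
Qed.

End BlowUp.

(** Complementing exchanges the entries 1 and -1, that is, [C] and [- C]. *)
Lemma adjmx_lcompl_blowup (R : realType) p n (C : 'M[R]_p) (p0 : (0 < p)%N)
    (Cs : C^T = C) (C1 : forall i j, C i j = 1 \/ C i j = -1)
    (Ns : (- C)^T = - C) :
  adjmx R (lcompl (blowup n p0 Cs)) = adjmx R (blowup n p0 Ns).
Proof.
apply/matrixP => u v; rewrite !mxE !ffunE /=; congr (nat_of_bool _)%:R.
have -> : blowup_entry (- C) p0 u v = - blowup_entry C p0 u v.
  by rewrite /blowup_entry mxE mulrN mulNr.
have N11 : (-1 == 1 :> R) = false.
  by rewrite lt_eqF ?(lt_trans (ltrN10 _)) ?ltr01.
by case: (blowup_entry_sign p0 C1 u v) => ->; rewrite ?opprK ?eqxx ?N11.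
Qed.

(** The hypotheses on [C] pass to [- C], which gives the complement; as entries are signs, the trace
    of [C *m C] is the square of [p]. *)
Lemma blowup_lambda_ge (R : realType) p n (C : 'M[R]_p) (p0 : (0 < p)%N)
    (Cs : C^T = C) (C1 : forall i j, C i j = 1 \/ C i j = -1) c k t :
  (t.*2 * p <= n)%N -> (0 < t)%N -> 0 < c <= p%:R ->
  C *m C *m C = c ^+ 2 *: C -> \tr C = 0 ->
  p%:R ^+ 2 = (2 * k.+1)%:R * c ^+ 2 ->
  t%:R * c <= lambda R k.+2 (blowup n p0 Cs) /\
  t%:R * c <= lambda R k.+2 (lcompl (blowup n p0 Cs)).
Proof.
move=> tpn t0 /andP[c0 cp] C3 trC pE.
have Ns : (- C)^T = - C by rewrite linearN /= Cs.
have N1 i j : (- C) i j = 1 \/ (- C) i j = -1.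
  by rewrite mxE; case: (C1 i j) => ->; rewrite ?opprK; auto.
have trCC : \tr (C *m C) = (2 * k.+1)%:R * c ^+ 2.
  rewrite -pE /mxtrace (eq_bigr (fun=> p%:R)) => [|i _].
    by rewrite sumr_const card_ord -[LHS]mulr_natr expr2.
  rewrite mxE (eq_bigr (fun=> 1)) => [|j _];
    first by rewrite sumr_const card_ord.
  have -> : C j i = C i j by rewrite -[in LHS]Cs mxE.
  by case: (C1 i j) => ->; rewrite ?mulrNN mulr1.
have eC := eigenvalue_ge_flat Cs c0 C3 trC trCC.
have eN : c <= nth 0 (eigenvalues (- C)) k.
  apply: eigenvalue_ge_flat => //.
  - by rewrite !(mulNmx, mulmxN) opprK C3 scalerN.
  - by rewrite linearN /= trC oppr0.
  - by rewrite mulNmx mulmxN opprK.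
(* Out of range, [nth] would return 0, which is below [c]. *)
have kp : (k < p)%N.
  rewrite ltnNge; apply/negP => pk; move: eC.
  by rewrite nth_default ?size_eigenvalues // leNgt c0.
have cp' : 0 <= c <= p%:R by rewrite ltW.
by split; rewrite /lambda ?(adjmx_lcompl_blowup _ _ Cs C1 Ns);
  apply: blowup_eigenvalue_ge => //.
Qed.

Fact unloop_subproof n (G : lgraph n) :
  symb [ffun e : 'I_n * 'I_n => (e.1 != e.2) && adj G e].
Proof. by apply/symbP => u v; rewrite !ffunE /= adjC eq_sym. Qed.

Definition unloop n (G : lgraph n) := LGraph (unloop_subproof G).

Lemma loopless_unloop n (G : lgraph n) : loopless (unloop G).
Proof. by apply/forallP => v; rewrite ffunE /= eqxx. Qed.

Lemma qf_diag_bool_le (R : realFieldType) n (b : 'I_n -> bool) (x : 'rV[R]_n) :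
  qf (diag_mx (\row_u (b u)%:R)) x <= 1 * qf 1%:M x.
Proof.
rewrite mul1r qf1E /qf mxE; apply: ler_sum => u _; rewrite mul_mx_diag !mxE.
by case: (b u) => /=; rewrite ?mulr0 ?mul0r ?mulr1 -?expr2 ?sqr_ge0.
Qed.

(** The deleted loops form a 0/1 diagonal matrix, whose form is at most the squared norm. *)
Lemma lambda_le_unloop (R : realType) n (G : lgraph n) k : (0 < k <= n)%N ->
  lambda R k G <= lambda R k (unloop G) + 1.
Proof.
move=> /andP[k0 kn]; rewrite /lambda.
have -> : adjmx R G =
    adjmx R (unloop G) + diag_mx (\row_u (adj G (u, u))%:R).
  apply/matrixP => u v; rewrite !mxE ffunE /=; case: eqVneq => [->|_] /=.
    by rewrite add0r.
  by rewrite mulr0n addr0.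
apply: eigenvaluesD_le0; rewrite ?adjmx_sym ?tr_diag_mx //.
- by case: k k0 kn.
- by move=> x; apply: (qf_diag_bool_le (fun u => adj G (u, u))).
Qed.

(** Deleting loops turns the looped complement into the simple one. *)
Lemma lambda_lcompl_le_unloop (R : realType) n (G : lgraph n) k :
  (0 < k <= n)%N ->
  lambda R k (lcompl G) <= lambda R k (scompl (unloop G)) + 1.
Proof.
move=> /lambda_le_unloop -/(_ R (lcompl G)).
suff -> : scompl (unloop G) = unloop (lcompl G) by [].
apply: val_inj; apply/ffunP => -[u v]; rewrite !ffunE /=.
by case: eqVneq.
Qed.

(** * Flat sign matrices from symmetric Hadamard matrices *)

Lemma sum_multiple (R : pzRingType) (I : finType) (f : I -> R) s :
  (forall i, [\/ f i = 0, f i = s | f i = - s]) ->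
  exists w : int, \sum_i f i = s * w%:~R.
Proof.
move=> fP; elim/big_ind: _ => [|_ _ [v ->] [w ->]|i _].
- by exists 0; rewrite mulr0.
- by exists (v + w); rewrite intrD mulrDr.
- case: (fP i) => ->; [exists 0|exists 1|exists (-1)].
  + by rewrite mulr0.
  + by rewrite mulr1.
  + by rewrite mulrN1z mulrN1.
Qed.

(** The trace is an integer [z] and, as a sum of eigenvalues, also [w] times the root of [m]; if it
    is nonzero, [m] is a rational and hence an integral square. *)
Lemma hadamard_square_order (R : realType) m (H : 'M[R]_m) :
  H^T = H -> hadamard H -> \tr H != 0 -> exists a, m = (a * a)%N.
Proof.
move=> Hs [H1 HH] tr0; rewrite Hs in HH.
have [z zE] : exists z : int, \tr H = 1 * z%:~R.
  apply: sum_multiple => i; case: (H1 i i) => ->; first by constructor 2.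
  by constructor 3.
have [w wE] : exists w : int, \tr H = Num.sqrt m%:R * w%:~R.
  rewrite -(sum_eigenvalues Hs); apply: sum_multiple => i.
  have H3 : H *m H *m H = m%:R *: H by rewrite HH mul_scalar_mx.
  apply: cube_eqP; rewrite sqr_sqrtr ?ler0n //.
  exact: (eigenvalues_cube Hs (ltn_ord i) H3).
have : (z%:~R ^+ 2 : R) = m%:R * w%:~R ^+ 2.
  by rewrite -[z%:~R]mul1r -zE wE exprMn sqr_sqrtr.
rewrite -!rmorphXn /= -[m%:R]/(m%:Z%:~R) -intrM => /intr_inj /(congr1 absz).
rewrite abszM !abszX /= => zw.
have w0 : (0 < `|w|)%N.
  by rewrite absz_gt0; apply: contraNneq tr0 => w0; rewrite wE w0 mulr0.
have /dvdnP[a aE] : (`|w| %| `|z|)%N.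
  by rewrite -(dvdn_pexp2r _ _ (isT : (0 < 2)%N)) zw dvdn_mull.
exists a; apply/eqP.
rewrite -(eqn_pmul2r (_ : 0 < `|w| ^ 2)%N) ?expn_gt0 ?w0 //.
by rewrite -zw aE expnMn mulnn.
Qed.

(** [i * i] has the parity of [i], so the signs alternate. *)
Lemma sum_signr_square (R : comPzRingType) b :
  \sum_(i < b.*2) (-1) ^+ (i * i) = 0 :> R.
Proof.
elim: b => [|b IHb]; first by rewrite big_ord0.
rewrite doubleS !big_ord_recr /= IHb add0r -signr_odd -[X in _ + X]signr_odd.
by rewrite !oddM !andbb /= odd_double expr0 expr1 subrr.
Qed.

Section SquareOrder.
Variables (R : comPzRingType) (a : nat) (H : 'M[R]_(a * a)).
Hypothesis H1 : forall u v, H u v = 1 \/ H u v = -1.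
Hypothesis HH : H *m H^T = (a * a)%:R%:M.

Let leq_aa : (a <= a * a)%N.
Proof. by case: (posnP a) => [->//|a0]; rewrite leq_pmulr. Qed.

Let w : 'I_a -> 'I_(a * a) := widen_ord leq_aa.

(** Each factor takes its row of [H] from one index and its column from the other, which makes [f]
    symmetric; only the first [a] rows occur. *)
Let f (x y : 'I_a * 'I_(a * a)) : R :=
  (-1) ^+ (x.1 * y.1) * (H (w y.1) x.2 * H (w x.1) y.2).

Definition square_order_mx : 'M[R]_#|{: 'I_a * 'I_(a * a)}| :=
  \matrix_(i, j) f (enum_val i) (enum_val j).

Let fC x y : f x y = f y x.
Proof. by rewrite /f mulnC [H _ _ * _]mulrC. Qed.

Lemma tr_square_order_mx : square_order_mx^T = square_order_mx.
Proof. by apply/matrixP => i j; rewrite !mxE fC. Qed.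

Lemma square_order_mx_sign i j :
  square_order_mx i j = 1 \/ square_order_mx i j = -1.
Proof.
rewrite mxE /f -signr_odd.
by case: (H1 (w (enum_val j).1) (enum_val i).2) => ->;
  case: (H1 (w (enum_val i).1) (enum_val j).2) => ->;
  case: (odd _); rewrite !(mulr1, mul1r, mulrN1, opprK) /=; auto.
Qed.

Let sum_enum (F : 'I_a * 'I_(a * a) -> R) :
  \sum_(i < #|{: 'I_a * 'I_(a * a)}|) F (enum_val i) = \sum_i \sum_u F (i, u).
Proof.
by rewrite pair_bigA /= -big_enum_val; apply: eq_big => -[].
Qed.

Let sum_row (i l : 'I_a) :
  \sum_u H (w i) u * H (w l) u = (a * a)%:R *+ (i == l).
Proof.
have /matrixP/(_ (w i) (w l)) := HH; rewrite !mxE => <-.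
by apply: eq_bigr => u _; rewrite mxE.
Qed.

(** Gram matrix of the columns of the first [a] rows of [H]; it scales each of these rows by
    [a * a]. *)
Let g (u v : 'I_(a * a)) := \sum_q H (w q) u * H (w q) v.

(** Orthogonality of the rows [x.1] and [y.1] of [H] leaves only the diagonal blocks, where the two
    signs cancel. *)
Let f2 x y : \sum_j \sum_u f x (j, u) * f (j, u) y =
  (a * a)%:R * g x.2 y.2 *+ (x.1 == y.1).
Proof.
rewrite /g mulrC mulr_suml -sumrMnl; apply: eq_bigr => j _; rewrite /f /=.
rewrite (eq_bigr (fun u => (-1) ^+ (x.1 * j) * (-1) ^+ (j * y.1) *
  (H (w j) x.2 * H (w j) y.2) * (H (w x.1) u * H (w y.1) u))) => [|u _];
  last by ring.
rewrite -mulr_sumr sum_row -mulrnAr; case: eqVneq => [->|_];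
  last by rewrite !mulr0n !mulr0.
by rewrite [(y.1 * j)%N]mulnC -expr2 sqrr_sign mul1r.
Qed.

(** By [f2] the square is block diagonal with blocks [a * a] times [g]. As a function of [u],
    [f (k, u) y] is a multiple of row [w y.1] of [H], which [g] scales by [a * a]. *)
Lemma square_order_mx_cube :
  square_order_mx *m square_order_mx *m square_order_mx =
    (a * a)%:R ^+ 2 *: square_order_mx.
Proof.
apply/matrixP => i j; rewrite mxE [RHS]mxE [square_order_mx i j]mxE.
set x := enum_val i; set y := enum_val j.
transitivity (\sum_k \sum_u ((a * a)%:R * g x.2 u *+ (x.1 == k)) * f (k, u) y).
  rewrite -(sum_enum (fun t =>
    ((a * a)%:R * g x.2 t.2 *+ (x.1 == t.1)) * f t y)).
  apply: eq_bigr => k _; rewrite [square_order_mx k j]mxE -/y.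
  congr (_ * _); rewrite mxE -f2.
  rewrite -(sum_enum (fun t => f x t * f t (enum_val k))).
  by apply: eq_bigr => l _; rewrite !mxE.
rewrite (bigD1 x.1) //= [X in _ + X]big1 ?addr0 => [|k kx]; last first.
  by apply: big1 => u _; rewrite eq_sym (negPf kx) mulr0n mul0r.
rewrite eqxx /=; under eq_bigr => u _ do rewrite mulr1n /g mulr_sumr mulr_suml.
rewrite exchange_big /= (bigD1 y.1) //= [X in _ + X]big1 ?addr0 => [|k ky].
  rewrite /f /=.
  rewrite (eq_bigr (fun u => (a * a)%:R * (-1) ^+ (x.1 * y.1) *
    H (w y.1) x.2 * H (w x.1) y.2 * (H (w y.1) u * H (w y.1) u))) => [|u _];
    last by ring.
  by rewrite -mulr_sumr sum_row eqxx mulr1n; ring.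
rewrite /f /=.
rewrite (eq_bigr (fun u => (a * a)%:R * (-1) ^+ (x.1 * y.1) *
  H (w k) x.2 * H (w x.1) y.2 * (H (w k) u * H (w y.1) u))) => [|u _];
  last by ring.
by rewrite -mulr_sumr sum_row (negPf ky) mulr0n mulr0.
Qed.

(** Block [i] contributes the sign of [i * i] times the squared length of a row; for even [a] the
    signs cancel. *)
Lemma trace_square_order_mx : ~~ odd a -> \tr square_order_mx = 0.
Proof.
move=> /even_halfK aE.
transitivity (\sum_i \sum_u f (i, u) (i, u)).
  by rewrite -(sum_enum (fun t => f t t)); apply: eq_bigr => i _; rewrite mxE.
under eq_bigr => i _ do rewrite /f /= -mulr_sumr sum_row eqxx mulr1n.
rewrite -mulr_suml; have := sum_signr_square R a./2.
by rewrite aE => ->; rewrite mul0r.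
Qed.

End SquareOrder.

(** With trace zero, [H] itself serves, [c] being the root of its order; otherwise the order is
    [a * a], and [square_order_mx], of order [a ^ 3], serves with [c = a ^ 2]. *)
Lemma exists_flat_sign_mx (R : realType) k (H : 'M[R]_(2 * k.+1)) :
  hadamard H -> H^T = H -> exists p (C : 'M[R]_p) c,
    [/\ C^T = C, forall i j, C i j = 1 \/ C i j = -1, C *m C *m C = c ^+ 2 *: C,
        \tr C = 0 & 0 < c /\ p%:R = c * Num.sqrt (2 * k.+1%:R)].
Proof.
move=> hH Hs; have [trH|trH] := eqVneq (\tr H) 0.
  exists (2 * k.+1)%N, H, (Num.sqrt (2 * k.+1)%:R); case: hH => H1 HH.
  split=> //; rewrite ?sqr_sqrtr ?ler0n //.
    by rewrite -[X in H *m X *m _]Hs HH mul_scalar_mx.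
  by rewrite sqrtr_gt0 ltr0n -[2 * k.+1%:R]natrM -expr2 sqr_sqrtr ?ler0n.
have [a aE] := hadamard_square_order Hs hH trH.
have sqrtE : Num.sqrt (2 * k.+1%:R) = a%:R :> R.
  by rewrite -natrM aE natrM -expr2 sqrtr_sqr ger0_norm ?ler0n.
have a0 : (0 < a)%N by case: a aE {sqrtE} => //.
have a_even : ~~ odd a by rewrite -[odd a]andbb -oddM -aE oddM.
move: H hH {Hs trH}; rewrite aE => H [H1 HH].
exists _, (square_order_mx H), (a * a)%:R; split.
- exact: tr_square_order_mx.
- exact: square_order_mx_sign.
- exact: square_order_mx_cube.
- exact: trace_square_order_mx.
by rewrite sqrtE card_prod !card_ord ltr0n muln_gt0 a0 -natrM mulnC.
Qed.

(** One [p] for all [n] and [t] serves twice: [t = 1] gives equality, [t] near [n / (2 * p)] the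
    limit. *)
Lemma exists_lambda_ge (R : realType) k (H : 'M[R]_(2 * k.+1)) :
  hadamard H -> H^T = H -> exists2 p, (0 < p)%N &
    forall n t, (t.*2 * p <= n)%N -> (0 < t)%N -> exists G : lgraph n,
      t%:R * p%:R / Num.sqrt (2 * k.+1%:R) <= lambda R k.+2 G /\
      t%:R * p%:R / Num.sqrt (2 * k.+1%:R) <= lambda R k.+2 (lcompl G).
Proof.
move=> hH Hs.
have [p [C [c [Cs C1 C3 trC [c0 pE]]]]] := exists_flat_sign_mx hH Hs.
(* This ensures [c <= p], as the blow-up requires. *)
have s1 : 1 <= Num.sqrt (2 * k.+1%:R) :> R.
  by rewrite -[leLHS]sqrtr1 ler_wsqrtr // -natrM ler1n muln_gt0.
have s0 : 0 < Num.sqrt (2 * k.+1%:R) :> R := lt_le_trans ltr01 s1.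
have p0 : (0 < p)%N by rewrite -(ltr0n R) pE mulr_gt0.
exists p => // n t tpn t0; exists (blowup n p0 Cs).
rewrite -mulrA pE mulfK ?gt_eqF //; apply: blowup_lambda_ge => //.
  by rewrite c0 pE ler_peMr // ltW.
by rewrite pE exprMn sqr_sqrtr ?mulr_ge0 ?ler0n // natrM mulrC.
Qed.

(** * Value of the limit and assembly of the bounds *)

Lemma alpha_eq (R : realType) i j (a b : R) N :
  (forall n, (N <= n)%N ->
     n%:R * a - b <= max_lambda_sum R i j n <= n%:R * a) ->
  alpha R i j = a.
Proof.
move=> ab; apply/cvg_lim => //.
have invn : (fun n : nat => n%:R^-1 : R) @ \oo --> (0 : R).
  by rewrite -cvg_shiftS; apply: cvg_harmonic.
have lo : (fun n : nat => a - b * n%:R^-1) @ \oo --> a.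
  rewrite -[X in _ --> X]subr0 -[X in _ --> _ - X](mulr0 b).
  by apply: cvgB; [exact: cvg_cst|apply: cvgM => //; exact: cvg_cst].
apply: squeeze_cvgr lo (cvg_cst a); near=> n.
have n0 : 0 < n%:R :> R by rewrite ltr0n; near: n; exact: nbhs_infty_gt.
have /ab/andP[abn an] : (N <= n)%N by near: n; exact: nbhs_infty_ge.
rewrite ler_pdivlMr // ler_pdivrMr // mulrBl mulfVK ?gt_eqF //.
by rewrite ![a * _]mulrC abn.
Unshelve. all: by end_near. Qed.

Lemma max_lambda_sum_ge (R : realType) n (G : lgraph n) i j :
  (0 < i)%N -> (0 < j)%N -> (maxn i j <= n)%N ->
  lambda R i G + lambda R j (lcompl G) - 2 <= max_lambda_sum R i j n.
Proof.
move=> i0 j0; rewrite geq_max => /andP[iN jN].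
have [_ /(_ _ (loopless_unloop G))] := max_lambda_sumP R i j n.
apply: le_trans; rewrite /lambda_sum lerBlDr.
apply: le_trans
  (lerD (lambda_le_unloop R G _) (lambda_lcompl_le_unloop R G _)) _.
- by rewrite i0.
- by rewrite j0.
by rewrite addrACA.
Qed.

(** Identifies the general bound at equal indices with the closed form of the third claim. *)
Lemma half_sqrt_double_inv (R : realType) k :
  1 / 2 * Num.sqrt (k.+1%:R^-1 + k.+1%:R^-1) = (Num.sqrt (2 * k.+1%:R))^-1 :> R.
Proof.
have : 0 < k.+1%:R :> R by [].
move: k.+1%:R => x x0; have x_neq0 := lt0r_neq0 x0; have x_ge0 := ltW x0.
have -> : x^-1 + x^-1 = 2 ^+ 2 * (2 * x)^-1 by field.
rewrite (sqrtrM _ (sqr_ge0 2)) sqrtr_sqr ger0_norm // sqrtrV ?mulr_ge0 //.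
by rewrite mulrA div1r mulVf ?mul1r // pnatr_eq0.
Qed.

Unset Implicit Arguments.

Theorem theorem2 (R : realType) (j : nat) (hj : (2 <= j)%N) :
  (forall i : nat, (2 <= i)%N ->
     (forall (n : nat) (G : lgraph n), (maxn i j <= n)%N ->
        lambda R i G + lambda R j (lcompl G)
          <= n%:R / 2
             * Num.sqrt ((i%:R + j%:R - 2) / ((i%:R - 1) * (j%:R - 1))))
     /\ alpha R i j
          <= 1 / 2 * Num.sqrt ((i%:R + j%:R - 2) / ((i%:R - 1) * (j%:R - 1))))
  /\
  ((forall (n : nat) (G : lgraph n), (j <= n)%N ->
      lambda R 1 G + lambda R j (lcompl G)
        <= n%:R / 2 * (1 + Num.sqrt (j%:R / (j%:R - 1))))
   /\ alpha R 1 j <= 1 / 2 * (1 + Num.sqrt (j%:R / (j%:R - 1))))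
  /\
  (forall k : nat, (1 <= k)%N ->
     (forall (n : nat) (G : lgraph n), (k.+1 <= n)%N ->
        lambda R k.+1 G + lambda R k.+1 (lcompl G)
          <= n%:R / Num.sqrt (2 * k%:R))
     /\ ((exists H : 'M[R]_(2 * k), hadamard H /\ H^T = H) ->
           (exists (n : nat) (G : lgraph n), (k.+1 <= n)%N /\
              lambda R k.+1 G + lambda R k.+1 (lcompl G)
                = n%:R / Num.sqrt (2 * k%:R))
           /\ alpha R k.+1 k.+1 = 1 / Num.sqrt (2 * k%:R))).
Proof.
have ratio2 l : l.+2%:R / (l.+2%:R - 1) = 1 + l.+1%:R^-1 :> R.
  have l0 : l.+1%:R != 0 :> R by rewrite pnatr_eq0.
  by rewrite -(natr1 l.+1); move: l.+1%:R l0 => x x0; field.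
have ratio k l : (k.+2%:R + l.+2%:R - 2) / ((k.+2%:R - 1) * (l.+2%:R - 1))
    = k.+1%:R^-1 + l.+1%:R^-1 :> R.
  have l0 : l.+1%:R != 0 :> R by rewrite pnatr_eq0.
  have k0 : k.+1%:R != 0 :> R by rewrite pnatr_eq0.
  rewrite -(natr1 l.+1) -(natr1 k.+1).
  by move: l.+1%:R k.+1%:R l0 k0 => x y x0 y0; field; rewrite x0.
have le_pair k n (G : lgraph n) : (k.+2 <= n)%N ->
    lambda R k.+2 G + lambda R k.+2 (lcompl G)
      <= n%:R / Num.sqrt (2 * k.+1%:R).
  move=> kn; rewrite -half_sqrt_double_inv mulrA mulrA mulr1.
  by apply: lambda_pair_le; rewrite maxnn.
case: j hj => [//|[//|l]] _; split=> [[//|[//|k]] _|].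
  split=> [n G kln|]; rewrite ratio; first exact: lambda_pair_le.
  apply: alpha_le => //; first by rewrite mulr_ge0 ?divr_ge0 ?sqrtr_ge0.
  by move=> n G /lambda_pair_le; rewrite mulrA mulrA mulr1; apply.
split.
  split=> [n G ln|]; rewrite ratio2; first exact: lambda1_pair_le.
  apply: alpha_le => //.
    by rewrite mulr_ge0 ?divr_ge0 ?addr_ge0 ?sqrtr_ge0.
  move=> n G; rewrite geq_max => /andP[_] /lambda1_pair_le.
  by rewrite mulrA mulrA mulr1; apply.
move=> [//|k] _; split=> [n G|[H [hH Hs]]]; first exact: le_pair.
have [p p0 lo] := exists_lambda_ge hH Hs; set s := Num.sqrt _ in lo *.
have s0 : 0 < s by rewrite sqrtr_gt0 mulr_gt0.
(* For [n = 2 * p] and [t = 1] each eigenvalue is at least [p / s], and twice this is the upper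
   bound. *)
have [|G [lG lG']] := lo (2 * p)%N 1%N _ isT; first by rewrite -muln2.
have kp : (k.+2 <= 2 * p)%N.
  rewrite ltnNge; apply/negP => pk; move: lG; rewrite /lambda /=.
  rewrite nth_default ?size_eigenvalues ?adjmx_sym // leNgt.
  by rewrite divr_gt0 // mul1r ltr0n.
split.
  exists (2 * p)%N, G; split=> //; apply/eqP; rewrite eq_le le_pair //=.
  by apply: le_trans (lerD lG lG');
    rewrite natrM mul1r -mulrDl mulr_natl mulr2n.
(* The error allows [2 * p / s] for rounding [n] down to a multiple of [2 * p], and 2 for deleting
   loops in both graphs. *)
rewrite div1r; apply: (@alpha_eq _ _ _ _ (2 * p%:R / s + 2) (2 * p)%N) => n pn.
apply/andP; split; last first.
  apply: max_lambda_sum_le => //; first by rewrite maxnn (leq_trans kp).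
  by move=> G1; apply: le_pair; apply: leq_trans pn.
pose t := (n %/ (2 * p))%N.
have t0 : (0 < t)%N by rewrite divn_gt0 // muln_gt0.
have tn : (t.*2 * p <= n)%N by rewrite -muln2 -mulnA leq_trunc_div.
have {lG lG'} [{}G [lG lG']] := lo n t tn t0.
apply: le_trans (@max_lambda_sum_ge R n G _ _ _ _ _) => //; last first.
  by rewrite maxnn (leq_trans kp).
rewrite opprD addrA lerD2r; apply: le_trans (lerD lG lG').
rewrite -mulrBl -mulrDl ler_pM2r ?invr_gt0 // lerBlDr.
have : (n <= t * p + t * p + 2 * p)%N by have := divn_eq n (2 * p);
  have := ltn_pmod n (_ : 0 < 2 * p)%N; rewrite -/t muln_gt0 p0; nia.
by rewrite -!natrM -!natrD ler_nat.
Qed.
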